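(* Let $n,k$ be positive integers with $k>n$. For any complex number $t$ such that $\lvert t\rvert\leq 1$, we have \[\sum_{r=1}^n\ \sum_{\mathbf{k}\in I'(r)}\ \sum_{m_1,\ldots,m_n=1}^\infty\frac{(1-t^{m_1})(1-t^{m_2})\cdots(1-t^{m_r})}{m_1^{k_1}(m_1+m_2)^{k_2}\cdots(m_1+\cdots+m_n)^{k_n}}=\sum_{m=1}^\infty\frac{1-t^m}{m^k}.\]
   Context: $\mathbb{N}=\{1,2,\ldots\}$. For fixed $n,k\in\mathbb{N}$ with $k>n$ and $r\in\{1,\ldots,n\}$, \[I(r)=\bigl\{\mathbf{k}=(k_1,\ldots,k_n)\in\mathbb{N}^n \bigm| k_n\geq 2,\ k_1+\cdots+k_n=k,\ k_1=\cdots=k_{r-1}=1\bigr\},\] and $I(n+1)=\emptyset$. Put $I'(r)=I(r)\setminus I(r+1)$ for $r=1,\ldots,n$. *)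

(* Defs.v *)
From HB Require Import structures.
From mathcomp Require Import all_boot all_order all_algebra.
From mathcomp Require Export complex.
From mathcomp Require Import all_classical all_reals topology normedtype sequences.
From mathcomp.analysis.showcase Require Export summability.
Import Order.TTheory GRing.Theory Num.Theory.
Import numFieldNormedType.Exports.

Set Implicit Arguments.
Unset Strict Implicit.
Unset Printing Implicit Defensive.

Local Open Scope ring_scope.

(* The index [i : 'I_n] stands for the position [i + 1]: [kk i] is k_{i+1}.
   The entries are positive with sum k, hence at most k, so that ['I_k.+1] is
   large enough to hold them and the index set is finite. *)
Definition index_set (n k r : nat) : {set {ffun 'I_n -> 'I_k.+1}} :=
  if (r <= n)%N then
    [set kk : {ffun 'I_n -> 'I_k.+1} |
      [&& [forall i, 0 < kk i]%N,
          [forall i : 'I_n, (i.+1 == n) ==> (2 <= kk i)%N],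
          (\sum_(i < n) kk i == k)%N
        & [forall i : 'I_n, (i.+1 <= r.-1)%N ==> (kk i == 1 :> nat)%N]]]
  else finset.set0.

Definition index_set' (n k r : nat) : {set {ffun 'I_n -> 'I_k.+1}} :=
  (index_set n k r :\: index_set n k r.+1)%SET.

(* [m i : nat] stands for the summation variable m_{i+1} - 1.  The values are
   taken in [R[i]^o] because it is [_^o] that carries the norm topology. *)
Definition multi_term (R : realType) (n k r : nat) (t : R[i])
    (kk : {ffun 'I_n -> 'I_k.+1}) (m : {ffun 'I_n -> nat}) : R[i]^o :=
  (\prod_(i < n | (i < r)%N) (1 - t ^+ (m i).+1)) /
  (\prod_(i < n) ((\sum_(j < n | (j <= i)%N) (m j).+1)%N%:R : R[i]) ^+ kk i).

(* [m : nat] stands for the summation variable minus 1. *)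
Definition single_term (R : realType) (k : nat) (t : R[i]) (m : nat) : R[i]^o :=
  (1 - t ^+ m.+1) / (m.+1%:R : R[i]) ^+ k.

(* Main.v *)
(* Let y mark n - 1 and x mark k - n - 1, put s_i = m_1 + ... + m_i and truncate
   all sums at s_n <= M.  Summing over the exponents turns the factors 1/s_i^(k_i),
   from the first k_i >= 2 on, into factors 1/(s_i - x).  Peeling off s_1, s_2, ...
   and expanding in powers of t, the truncated left-hand side, which vanishes at
   t = 1, is a constant minus
     sum_j t^j c_j sum_(j <= a <= M) d_(a-j) g(a),
   where c_j and d_i are the coefficients of z(1-z)^(y-1) and (1-z)^(-y), and
   (a - x) g(a) = (a + 1 - x + y) g(a+1) + 1/(a(a+1)).  This recurrence makes
     (j - x) sum_a d_(a-j) g(a) = sum_a d_(a-j) / a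
   telescope exactly, so the truncated left-hand side equals
     sum_(j <= M) (1 - t^j) / (j - x) * c_j sum_(j <= a <= M) d_(a-j) / a.
   Finally c_j sum_(j <= a <= M) d_(a-j) / a tends to 1/(j - y) coefficientwise in y,
   with an error bounded by a power of the harmonic sum H_M over M - j + 1, so that
   the total error is at most a power of H_M over M.  At t = 0 the same estimate
   bounds the sums of absolute values. *)

Require Import Defs.
From mathcomp Require Import all_boot all_order all_algebra finmap.
From mathcomp Require Import all_classical all_reals topology normedtype sequences.
From mathcomp Require Import ring lra zify.
Import Order.TTheory GRing.Theory Num.Theory.
Import numFieldNormedType.Exports.

Set Implicit Arguments.
Unset Strict Implicit.
Unset Printing Implicit Defensive.

Local Open Scope classical_set_scope.
Local Open Scope ring_scope.

(* Declared inside a section, this instance is not exported by its library. *)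
#[local] Existing Instance totally_filter.

(** * Power series in z with coefficients polynomial in y *)

Section Coefficients.
Variable F : numFieldType.
Implicit Types (s : F) (i : nat).

(* With y = 'X, [rprod s i] and [bincoef s i] are the coefficients of z^i in
   z(1 - z)^(-sy-1) and (1 - z)^(-sy). *)
Definition rprod s i : {poly F} :=
  if i is i'.+1 then \prod_(l < i') (1 + (s / l.+1%:R) *: 'X) else 0.

Definition bincoef s i : {poly F} :=
  if i is 0 then 1 else (s / i%:R) *: ('X * rprod s i).

Lemma bincoefE s i : i%:R *: bincoef s i = s *: ('X * rprod s i).
Proof.
case: i => [|i]; first by rewrite scale0r mulr0 scaler0.
by rewrite /bincoef scalerA mulrCA divff ?mulr1 // pnatr_eq0.
Qed.

Lemma rprodS s i : rprod s i.+1 = rprod s i + bincoef s i.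
Proof.
case: i => [|i]; first by rewrite /rprod big_ord0 add0r.
by rewrite /bincoef /rprod big_ord_recr /= mulrDr mulr1 -scalerAr (mulrC 'X).
Qed.

Lemma bincoefS s i :
  i.+1%:R *: bincoef s i.+1 = (i%:R + s *: 'X) * bincoef s i.
Proof.
rewrite bincoefE rprodS mulrDr scalerDr -bincoefE mulrDl -scalerAl.
by rewrite mulr_natl scaler_nat.
Qed.

(** With a = i + j and m = M - j this is the sum of d_(a-j) / a over j <= a <= M. *)
Definition bintail m j : {poly F} :=
  \sum_(i < m.+1) (i + j)%:R^-1 *: bincoef 1 i.

Variable t : F.

(* The coefficient of z^a in p(tz) q(z). *)
Definition conv (p q : nat -> {poly F}) a : {poly F} :=
  \sum_(j < a.+1) t ^+ j *: (p j * q (a - j)%N).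

Lemma convDl p1 p2 q a :
  conv (fun j => p1 j + p2 j) q a = conv p1 q a + conv p2 q a.
Proof.
by rewrite -big_split; apply: eq_bigr => j _; rewrite mulrDl scalerDr.
Qed.

Lemma convDr p q1 q2 a :
  conv p (fun j => q1 j + q2 j) a = conv p q1 a + conv p q2 a.
Proof.
by rewrite -big_split; apply: eq_bigr => j _; rewrite mulrDr scalerDr.
Qed.

Lemma conv_recr p q a : q 0 = 0 -> conv p q a.+1 = conv p (q \o succn) a.
Proof.
move=> q0; rewrite /conv big_ord_recr /= subnn q0 mulr0 scaler0 addr0.
by apply: eq_bigr => j _; rewrite subSn // -ltnS.
Qed.

Lemma conv_recl p q a : p 0 = 0 -> conv p q a.+1 = t *: conv (p \o succn) q a.
Proof.
move=> p0; rewrite /conv big_ord_recl /= p0 mul0r scaler0 add0r scaler_sumr.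
by apply: eq_bigr => j _; rewrite scalerA exprS subSS.
Qed.

Lemma eq_conv p1 p2 q1 q2 : p1 =1 p2 -> q1 =1 q2 -> conv p1 q1 =1 conv p2 q2.
Proof. by move=> ep eq a; apply: eq_bigr => j _; rewrite ep eq. Qed.

(* The coefficients of G, zG/(1 - z) and tzG/(1 - tz), where
   G = ((1 - tz)/(1 - z))^y. *)
Definition vser := conv (bincoef (-1)) (bincoef 1).
Definition aser := conv (bincoef (-1)) (rprod 1).
Definition user := conv (rprod (-1)) (bincoef 1).

Lemma aserS a : aser a.+1 = aser a + vser a.
Proof.
by rewrite /aser conv_recr // -convDr; apply: eq_conv => // j; exact: rprodS.
Qed.

Lemma userS a : user a.+1 = t *: (user a + vser a).
Proof.
rewrite /user conv_recl // -convDl; congr (_ *: _).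
by apply: eq_conv => // j; exact: rprodS.
Qed.

Lemma aser_sum a : aser a = \sum_(s < a) vser s.
Proof.
elim: a => [|a IH]; last by rewrite aserS big_ord_recr IH.
by rewrite big_ord0 /aser /conv big_ord_recl big_ord0 /= mulr0 scaler0 addr0.
Qed.

Lemma user_sum a : user a = \sum_(s < a) t ^+ (a - s) *: vser s.
Proof.
elim: a => [|a IH].
  by rewrite big_ord0 /user /conv big_ord_recl big_ord0 /= mul0r scaler0 addr0.
rewrite userS big_ord_recr /= subSnn expr1 IH scalerDr scaler_sumr; congr (_ + _).
by apply: eq_bigr => s _; rewrite scalerA -exprS subSn // ltnW.
Qed.

(** Coefficientwise form of z G' = y (z G / (1 - z) - t z G / (1 - t z)), the logarithmic derivative
    of G. *)
Lemma vserE a : a%:R *: vser a = 'X * \sum_(s < a) (1 - t ^+ (a - s)) *: vser s.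
Proof.
have -> : \sum_(s < a) (1 - t ^+ (a - s)) *: vser s = aser a - user a.
  rewrite aser_sum user_sum -sumrB; apply: eq_bigr => s _.
  by rewrite scalerBl scale1r.
rewrite mulrBr /vser /aser /user /conv !mulr_sumr scaler_sumr -sumrB.
apply: eq_bigr => j _.
have ja : (j <= a)%N by rewrite -ltnS.
rewrite scalerA mulrC -scalerA -!scalerAr -scalerBr; congr (_ *: _).
(* Leibniz rule: the factor a is distributed over the two series. *)
have -> : a%:R = j%:R + (a - j)%:R :> F by rewrite -natrD subnKC.
rewrite scalerDl scalerAl bincoefE [(a - j)%:R *: _]scalerAr bincoefE.
by rewrite scale1r scaleN1r; ring.
Qed.

Lemma vser0 : vser 0 = 1.
Proof. by rewrite /vser /conv big_ord_recl big_ord0 /= addr0 mulr1 expr0 scale1r. Qed.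

End Coefficients.

Arguments bincoef : simpl never.
Arguments rprod : simpl never.

(** * Exact evaluation of the truncated sum *)

Section Truncated.
Variables (F : numFieldType) (M : nat).

(* If [f h a] is the coefficient of x^h in a series f(a), then [xdiv f h a] is the
   coefficient of x^h in f(a)/(a - x). *)
Definition xdiv (f : nat -> nat -> F) h a : F :=
  \sum_(i < h.+1) f (h - i)%N a / a%:R ^+ i.+1.

(* [Tsum n h s] is the coefficient of x^h in the sum over s < s_1 < ... < s_n <= M
   of 1/((s_1 - x) ... (s_n - x) s_n).  [Psum] only differs in that the factors
   1 - t^(s_i - s_(i-1)) are included up to and including the first index i whose
   exponent is at least 2. *)
Fixpoint Tsum n (h s : nat) : F :=
  if n is n'.+1 then \sum_(s.+1 <= a < M.+1) xdiv (Tsum n') h a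
  else (h == 0)%:R / s%:R.

Fixpoint Psum (t : F) n (h s : nat) : F :=
  if n is n'.+1 then
    \sum_(s.+1 <= a < M.+1) (1 - t ^+ (a - s)) *
      (Psum t n' h a / a%:R + (xdiv (Tsum n') h a - Tsum n' h a / a%:R))
  else (h == 0)%:R / s%:R.

Lemma xdiv0 f a : xdiv f 0 a = f 0%N a / a%:R.
Proof. by rewrite /xdiv big_ord_recl big_ord0 addr0 subn0. Qed.

Lemma xdivS f h a : xdiv f h.+1 a = (f h.+1 a + xdiv f h a) / a%:R.
Proof.
rewrite /xdiv big_ord_recl subn0 mulrDl; congr (_ + _).
rewrite mulr_suml; apply: eq_bigr => i _.
by rewrite /= /bump /= add1n subSS exprSr invfM mulrA.
Qed.

Lemma xdiv_eq0 f h a : (forall h', f h' a = 0) -> xdiv f h a = 0.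
Proof. by move=> f0; apply: big1 => i _; rewrite f0 mul0r. Qed.

Lemma Tsum_vanish n h s : (M - s < n)%N -> Tsum n h s = 0.
Proof.
elim: n h s => [//|n IH] h s Hn /=.
rewrite big_nat_cond; apply: big1 => a; rewrite andbT => /andP[sa aM].
apply: xdiv_eq0 => h'; apply: IH; rewrite ltnS in aM.
by rewrite -ltnS; apply: leq_trans Hn; rewrite ltnS ltn_sub2l // (leq_trans sa).
Qed.

Lemma Psum_vanish t n h s : (M - s < n)%N -> Psum t n h s = 0.
Proof.
elim: n h s => [//|n IH] h s Hn /=.
rewrite big_nat_cond; apply: big1 => a; rewrite andbT => /andP[sa aM].
have nMa : (M - a < n)%N.
  rewrite ltnS in aM.
  by rewrite -ltnS; apply: leq_trans Hn; rewrite ltnS ltn_sub2l // (leq_trans sa).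
rewrite IH // xdiv_eq0 => [|h']; last exact: Tsum_vanish.
by rewrite Tsum_vanish // !mul0r subr0 addr0 mulr0.
Qed.

Lemma Tsum_step n h s : (s < M)%N ->
  Tsum n.+1 h s = xdiv (Tsum n) h s.+1 + Tsum n.+1 h s.+1.
Proof. by move=> sM; rewrite /= big_ltn. Qed.

(* By [Tsum_vanish] the polynomials below do not lose any coefficient, so that the
   relations between them hold exactly. *)
Variable N : nat.
Hypothesis MN : (M.+1 < N)%N.

Definition Tpoly h a : {poly F} := \poly_(n < N) Tsum n h a.
Definition Gpoly h a : {poly F} := \poly_(n < N) xdiv (Tsum n) h a.

(** This and [GpolyS] are the coefficients in x of (a - x) g(a) = T(a), where g and T are the series
    with coefficients [Gpoly] and [Tpoly]. *)
Lemma Gpoly0 a : (0 < a)%N -> a%:R *: Gpoly 0 a = Tpoly 0 a.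
Proof.
move=> a0; apply/polyP => n; rewrite coefZ !coef_poly; case: ifP => _; last exact: mulr0.
by rewrite xdiv0 mulrC divfK // pnatr_eq0 -lt0n.
Qed.

Lemma GpolyS h a : (0 < a)%N -> a%:R *: Gpoly h.+1 a = Tpoly h.+1 a + Gpoly h a.
Proof.
move=> a0; apply/polyP => n; rewrite coefZ coefD !coef_poly.
case: ifP => _; last by rewrite mulr0 addr0.
by rewrite xdivS mulrC divfK // pnatr_eq0 -lt0n.
Qed.

Lemma TpolyM h : Tpoly h M = (h == 0)%:R *: (M%:R^-1)%:P.
Proof.
apply/polyP => n; rewrite coefZ coef_poly coefC.
case: n => [|n]; first by rewrite (leq_trans _ MN).
by rewrite Tsum_vanish ?subnn // if_same mulr0.
Qed.

(** The chains with s_1 = a + 1 give the term in [Gpoly]; the correction comes from the empty chain,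
    which contributes 1/a. *)
Lemma Tpoly_step h a : (a < M)%N ->
  Tpoly h a = Tpoly h a.+1 + 'X * Gpoly h a.+1
              + (h == 0)%:R *: (a%:R^-1 - a.+1%:R^-1)%:P.
Proof.
move=> aM; apply/polyP => n; rewrite !coefD coefZ coefXM !coef_poly coefC.
case: n => [|n]; first by rewrite (leq_trans _ MN) //= addr0; ring.
rewrite /= mulr0 addr0.
(* At n + 1 = N the product with 'X reaches past the truncation, but there [Tsum_vanish] applies. *)
case: ltnP => nN; last first.
  rewrite add0r; case: ltnP => // nN'; rewrite xdiv_eq0 // => h'.
  apply: Tsum_vanish; rewrite -ltnS; apply: (@leq_trans N) => //.
  by apply: leq_ltn_trans MN; rewrite ltnS leq_subr.
by rewrite (ltn_trans (ltnSn n) nN) -/(Tsum n.+1 h a) Tsum_step // addrC.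
Qed.

Local Notation d := (bincoef (1 : F)).

Local Notation B j := (bintail F (M - j) j).

Definition Hpoly h j : {poly F} := \sum_(i < (M - j).+1) d i * Gpoly h (i + j).

(* Here P is the coefficient of x^(h-1) in g, where that of x^h is [Gpoly h].  The
   sum of d_i ((j - x) g(i+j) - 1/(i+j)) - d_i ((j+1 - x) g(i+j+1) - 1/(i+j+1))
   telescopes, and its value vanishes for m = M - j by [TpolyM]. *)
Lemma Hpoly_telescope (P : nat -> {poly F}) h j m :
  (0 < j)%N -> (m + j <= M)%N ->
  (forall a, (0 < a)%N -> a%:R *: Gpoly h a - P a = Tpoly h a) ->
  \sum_(i < m.+1) d i * (j%:R *: Gpoly h (i + j) - P (i + j)%N
                         - (h == 0)%:R *: ((i + j)%:R^-1)%:P)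
  - \sum_(i < m) d i * (j.+1%:R *: Gpoly h (i + j).+1 - P (i + j).+1
                         - (h == 0)%:R *: ((i + j).+1%:R^-1)%:P)
  = d m * (Tpoly h (m + j) - (h == 0)%:R *: ((m + j)%:R^-1)%:P).
Proof.
move=> j0 mM GP; elim: m mM => [|m IH] mM.
  by rewrite big_ord_recl !big_ord0 subr0 addr0 /= add0n GP.
rewrite big_ord_recr [X in _ - X]big_ord_recr /= opprD addrACA IH; last exact: ltnW.
rewrite (Tpoly_step h mM).
have dS := bincoefS (1 : F) m.
have PE : P (m + j).+1 = (m + j).+1%:R *: Gpoly h (m + j).+1 - Tpoly h (m + j).+1.
  by rewrite -GP // opprB addrC subrK.
rewrite !addSn PE.
move: (Gpoly _ _) (Tpoly _ _) => G T.
rewrite -!mul_polyC in dS *.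
rewrite !polyC_natr polyCB in dS *.
move: ((m + j)%:R^-1%:P) ((m + j).+1%:R^-1%:P) => u v.
rewrite -[(m + j).+1]addSn natrD.
have -> : m.+1%:R = 1 + m%:R :> {poly F} by rewrite -natr1 addrC.
have -> : j.+1%:R = 1 + j%:R :> {poly F} by rewrite -natr1 addrC.
rewrite -natr1 polyC1 mul1r in dS.
move: ((h == 0)%:R) (d m) (d m.+1) (m%:R : {poly F}) dS => b dm dm1 m' dS.
(* The recurrence of the d_i, solved for a monomial so that [ring] can rewrite with it. *)
have dE : m' * dm1 = (m' + 'X) * dm - dm1 by rewrite -dS; ring.
ring: dE.
Qed.

(** For m = M - j the telescoped difference is a multiple of T(M) - 1/M = 0, so the sum [E] takes
    the same value at j and j + 1; it vanishes at j = M. *)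
Lemma Hpoly_vanish (P : nat -> {poly F}) h j : (0 < j <= M)%N ->
  (forall a, (0 < a)%N -> a%:R *: Gpoly h a - P a = Tpoly h a) ->
  j%:R *: Hpoly h j - \sum_(i < (M - j).+1) d i * P (i + j)%N
  = (h == 0)%:R *: B j.
Proof.
move=> /andP[j0 jM] GP.
pose E j := \sum_(i < (M - j).+1) d i * (j%:R *: Gpoly h (i + j) - P (i + j)%N
                         - (h == 0)%:R *: ((i + j)%:R^-1)%:P).
suff : E j = 0.
  rewrite /E => E0; apply/subr0_eq; rewrite -[RHS]E0 /Hpoly /bintail !scaler_sumr.
  rewrite -!sumrB; apply: eq_bigr => i _.
  by rewrite -!mul_polyC; ring.
move mE : (M - j)%N => m; elim: m j j0 jM mE => [|m IH] j j0 jM mE.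
  have {mE jM}jM : j = M by apply/eqP; rewrite eqn_leq jM /= -subn_eq0 mE.
  rewrite jM in j0 *; have := Hpoly_telescope (m := 0) j0 (leqnn M) GP.
  by rewrite big_ord0 subr0 add0n /E subnn TpolyM subrr mulr0.
have jM' : (j < M)%N by rewrite -subn_gt0 mE.
have := Hpoly_telescope (m := (M - j)%N) j0 _ GP.
rewrite subnK // TpolyM subrr mulr0 => /(_ (leqnn M)) /subr0_eq.
rewrite /E => ->; rewrite -subnSK // -[RHS](IH j.+1) //; last by rewrite subnS mE.
by apply: eq_bigr => i _; rewrite addnS.
Qed.

(** [Hpoly_vanish], with P = 0 for h = 0 and P = [Gpoly h] for h + 1, says that (j - x) H(j) = B(j);
    the expansion of 1/(j - x) is geometric. *)
Lemma HpolyE h j : (0 < j <= M)%N -> Hpoly h j = (j%:R ^+ h.+1)^-1 *: B j.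
Proof.
move=> j0M; have /andP[j0 jM] := j0M.
have jn0 : j%:R != 0 :> F by rewrite pnatr_eq0 -lt0n.
elim: h => [|h IH].
  have := @Hpoly_vanish (fun=> 0) 0 j j0M.
  rewrite (eq_bigr (fun=> 0)) => [|i _]; last exact: mulr0.
  rewrite big1 // subr0 scale1r => <- => [|a a0]; last by rewrite subr0 Gpoly0.
  by rewrite scalerA expr1 mulVf // scale1r.
have := @Hpoly_vanish (Gpoly h) h.+1 j j0M.
rewrite scale0r -/(Hpoly h j) IH => /(_ _)/subr0_eq H.
rewrite exprS invfM -scalerA -H ?scalerA ?mulVf ?scale1r // => a a0.
by rewrite GpolyS // addrK.
Qed.

Definition Dpoly t h s : {poly F} := \poly_(n < N) (Tsum n h s - Psum t n h s).

(** Subtracting the two recursions leaves t^(a-s) in front of the [xdiv] part and reproduces the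
    difference itself, divided by a. *)
Lemma DpolyE t h s :
  Dpoly t h s = 'X * \sum_(s.+1 <= a < M.+1)
     (t ^+ (a - s) *: Gpoly h a + ((1 - t ^+ (a - s)) / a%:R) *: Dpoly t h a).
Proof.
apply/polyP => n; rewrite coefXM coef_poly.
case: n => [|n]; first by rewrite /= subrr if_same.
rewrite /= coef_sum; case: ltnP => nN.
  rewrite -sumrB; apply: eq_bigr => a _.
  rewrite coefD !coefZ !coef_poly (ltn_trans _ nN) //; ring.
rewrite big1_seq // => a; rewrite mem_index_iota => /andP[_ /andP[_ aM]].
have vM : (M - a < n)%N.
  rewrite -ltnS; apply: leq_trans nN; apply: leq_ltn_trans MN.
  by rewrite ltnS leq_subr.
rewrite coefD !coefZ !coef_poly; case: ifP => _; last by rewrite !mulr0 addr0.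
rewrite Tsum_vanish // Psum_vanish // subrr mulr0 addr0 xdiv_eq0 ?mulr0 // => h'.
exact: Tsum_vanish.
Qed.

Lemma sum_triangle (V : nmodType) (f : nat -> nat -> V) m :
  \sum_(s < m) \sum_(s.+1 <= a < m) f s a = \sum_(a < m) \sum_(s < a) f s a.
Proof.
elim: m => [|m IH]; first by rewrite !big_ord0.
rewrite big_ord_recr [RHS]big_ord_recr /= big_geq // addr0 -IH -big_split /=.
by apply: eq_bigr => s _; rewrite big_nat_recr.
Qed.

Lemma sum_triangle_refl (V : nmodType) (f : nat -> nat -> V) m :
  \sum_(a < m) \sum_(j < a.+1) f j a = \sum_(j < m) \sum_(i < m - j) f j (i + j)%N.
Proof.
elim: m => [|m IH]; first by rewrite !big_ord0.
rewrite big_ord_recr [RHS]big_ord_recr /= IH subSnn [X in _ = _ + X]big_ord_recr.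
rewrite big_ord0 /= add0r add0n big_ord_recr /= addrA -big_split /=.
congr (_ + _); apply: eq_bigr => j _.
by rewrite subSn ?big_ord_recr /= ?subnK // ltnW.
Qed.

(** The recursion [DpolyE] is summed over s with weights v_s. By [vserE] the coefficient of
    [Dpoly t h a] on the right is again v_a for a > 0, so everything but s = 0 cancels. *)
Lemma Dpoly0 t h : Dpoly t h 0 = 'X * \sum_(a < M.+1) user t a * Gpoly h a.
Proof.
have H : \sum_(s < M.+1) vser t s * Dpoly t h s =
  'X * \sum_(a < M.+1) user t a * Gpoly h a +
  \sum_(a < M.+1) ((a != 0)%:R *: vser t a) * Dpoly t h a.
  under eq_bigr => s _ do rewrite DpolyE mulrCA mulr_sumr.
  rewrite -mulr_sumr (sum_triangle (fun s a => vser t s * (t ^+ (a - s) *: Gpoly h a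
    + ((1 - t ^+ (a - s)) / a%:R) *: Dpoly t h a))).
  rewrite !mulr_sumr -big_split /=; apply: eq_bigr => a _.
  (* The indicator is a/a, with 0/0 = 0. *)
  have -> : (a != 0)%:R *: vser t a = a%:R^-1 *: (a%:R *: vser t a).
    rewrite scalerA; case: eqP => [->|/eqP a0]; first by rewrite mulr0.
    by rewrite mulVf // pnatr_eq0.
  rewrite vserE user_sum scalerAr -mulrA -mulrDr; congr (_ * _).
  rewrite scaler_sumr !mulr_suml -big_split; apply: eq_bigr => s _ /=.
  rewrite mulrDr scalerA; congr (_ + _); first by rewrite -scalerAr scalerAl.
  by rewrite -scalerAr scalerAl [_ / _]mulrC.
rewrite big_ord_recl [X in _ = _ + X]big_ord_recl /= vser0 mul1r scale0r in H.
rewrite mul0r add0r in H; apply: (addIr _ (etrans H _)); congr (_ + _).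
by apply: eq_bigr => a _; rewrite scale1r.
Qed.

(** Collecting the powers t^j in [user] and putting a = i + j turns the inner sums into [Hpoly]; j =
    0 drops out because [rprod] is 0 there. *)
Lemma Dpoly0E t h :
  Dpoly t h 0 = 'X * \sum_(1 <= j < M.+1)
    (t ^+ j / j%:R ^+ h.+1) *: (rprod (-1) j * B j).
Proof.
rewrite Dpoly0; congr (_ * _).
under eq_bigr => a _ do rewrite /user /conv mulr_suml.
rewrite (sum_triangle_refl (fun j a => t ^+ j *: (rprod (-1) j * d (a - j)) * Gpoly h a)).
rewrite -(big_mkord xpredT (fun j => \sum_(i < M.+1 - j)
  t ^+ j *: (rprod (-1) j * d (i + j - j)) * Gpoly h (i + j))).
rewrite big_ltn // big1 ?add0r => [|i _]; last by rewrite mul0r scaler0 mul0r.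
rewrite big_nat_cond [RHS]big_nat_cond; apply: eq_bigr => j.
rewrite andbT ltnS => j1M; have /andP[j0 jM] := j1M.
rewrite -scalerA [_^-1 *: (_ * _)]scalerAr -HpolyE // subSn // /Hpoly.
rewrite mulr_sumr scaler_sumr.
by apply: eq_bigr => i _; rewrite addnK -scalerAl mulrA.
Qed.

End Truncated.

(* [Dpoly0E] gives [Tsum - Psum]; since [Psum] vanishes at t = 1, its instance at
   t = 1 evaluates [Tsum]. *)
Lemma PsumE (F : numFieldType) (M : nat) (t : F) n h :
  Psum M t n.+1 h 0 = \sum_(1 <= j < M.+1)
    (1 - t ^+ j) / j%:R ^+ h.+1 * (rprod (-1) j * bintail F (M - j) j)`_n.
Proof.
(* Beyond M + 1, for the exact polynomial relations, and beyond n + 1, the coefficient to be read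
   off. *)
pose N := (M + n).+2.
have MN : (M.+1 < N)%N by rewrite /N !ltnS leq_addr.
have nN : (n.+1 < N)%N by rewrite /N !ltnS leq_addl.
have H s : Tsum F M n.+1 h 0 - Psum M s n.+1 h 0 = \sum_(1 <= j < M.+1)
    s ^+ j / j%:R ^+ h.+1 * (rprod (-1) j * bintail F (M - j) j)`_n.
  have := congr1 (fun p : {poly F} => p`_n.+1) (Dpoly0E MN s h).
  rewrite coef_poly nN coefXM /= coef_sum => ->.
  by apply: eq_bigr => j _; rewrite coefZ.
have P1 : Psum M 1 n.+1 h 0 = 0 :> F.
  by rewrite /= big1 // => a _; rewrite expr1n subrr mul0r.
have := H 1; rewrite P1 subr0 => T1.
rewrite -[LHS](subKr (Tsum F M n.+1 h 0)) H T1 -sumrB; apply: eq_bigr => j _.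
by rewrite expr1n -mulrBl -mulrBl.
Qed.

(** * The limit of the truncated coefficients *)

Section Error.
Variable F : numFieldType.
Local Notation c := (rprod (-1 : F)).
Local Notation tail := (bintail F).
Local Notation d := (bincoef (1 : F)).

Definition harmonic_sum n : F := \sum_(l < n) l.+1%:R^-1.

Lemma harmonic_sum_ge0 n : 0 <= harmonic_sum n.
Proof. by apply: sumr_ge0 => l _; rewrite invr_ge0 ler0n. Qed.

Lemma le_harmonic_sum m n : (m <= n)%N -> harmonic_sum m <= harmonic_sum n.
Proof.
move=> /subnK <-; elim: (n - m)%N => // k IH; rewrite addSn.
by rewrite (le_trans IH)// /harmonic_sum big_ord_recr /= lerDl invr_ge0 ler0n.
Qed.

Lemma harmonic_sum_ge1 n : 1 <= harmonic_sum n.+1.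
Proof.
apply: le_trans (le_harmonic_sum (ltn0Sn n)).
by rewrite /harmonic_sum big_ord_recl big_ord0 addr0 invr1.
Qed.

(* The factor 1 - i/(i + j) is j/(i + j) unless i = j = 0, where it is 1 because
   0/0 = 0; this makes the case j = 0 of the identity usable. *)
Lemma tail_telescope m j :
  \sum_(i < m.+1) ((1 - i%:R / (i + j)%:R)%:P
                   - (j.+1%:R - 'X) * ((i + j).+1%:R^-1)%:P) * d i
  = (m.+1 + j)%:R^-1 *: ('X * rprod 1 m.+1).
Proof.
have nz k : k.+1%:R != 0 :> F by rewrite pnatr_eq0.
elim: m => [|m IH].
  rewrite big_ord_recl big_ord0 addr0 /= mul0r subr0 mulr1 add0n add1n.
  rewrite -mul_polyC /rprod big_ord0 mulr1 polyC1.
  have e : 1 = (j.+1%:R^-1)%:P * j.+1%:R :> {poly F}.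
    by rewrite -polyC_natr -polyCM mulVf // polyC1.
  by rewrite {1}e; ring.
rewrite big_ord_recr /= IH.
have D0 := bincoefE (1 : F) m.+1; rewrite scale1r in D0.
have D1 := bincoefE (1 : F) m.+2; rewrite scale1r in D1.
have D2 := bincoefS (1 : F) m.+1; rewrite scale1r in D2.
rewrite -D0 -D1 D2 -!mul_polyC.
have -> : (m.+2 + j)%N = (m.+1 + j).+1 by [].
have e1 : (m.+1 + j)%:R^-1 * m.+1%:R + (1 - m.+1%:R / (m.+1 + j)%:R) = 1 :> F.
  by rewrite [_^-1 * _]mulrC addrC subrK.
have e2 : 1 = ((m.+1 + j).+1%:R^-1)%:P * (m.+1%:R + j.+1%:R) :> {poly F}.
  by rewrite -natrD addnS -polyC_natr -polyCM mulVf ?polyC1.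
rewrite mulrA -polyCM -mulrDl addrA -polyCD e1 polyC1 [X in X - _]e2; ring.
Qed.

Lemma rprodNS j : (0 < j)%N -> j%:R * c j.+1 = (j%:R - 'X) * c j.
Proof.
move=> j0; rewrite rprodS mulrDr -[in X in _ + X]polyC_natr mul_polyC.
by rewrite bincoefE scaleN1r mulrBl.
Qed.

(** In [tail_telescope] with j = 0 only i = 0 survives in the first part, with value 1; this starts
    the recursion. *)
Lemma tailS m j :
  (j.+1%:R - 'X) * tail m j.+1 = (if j == 0%N then 1 else j%:R * tail m j)
                                 - (m.+1 + j)%:R^-1 *: ('X * rprod 1 m.+1).
Proof.
have <- : \sum_(i < m.+1) (1 - i%:R / (i + j)%:R)%:P * d i
          = if j == 0%N then 1 else j%:R * tail m j.
  case: j => [|j] /=.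
    rewrite big_ord_recl /= mul0r subr0 mulr1 big1 ?addr0 // => i _.
    by rewrite addn0 divff ?subrr ?mul0r // pnatr_eq0.
  rewrite mulr_sumr; apply: eq_bigr => i _.
  rewrite -mul_polyC mulrA; congr (_ * _); rewrite -polyC_natr -polyCM.
  congr _%:P; have nz : (i + j.+1)%:R != 0 :> F by rewrite pnatr_eq0 addnS.
  by rewrite -{1}(divff nz) -mulrBl natrD [_ + j.+1%:R]addrC addrK.
rewrite -tail_telescope /bintail mulr_sumr -sumrB; apply: eq_bigr => i _.
by rewrite addnS -mul_polyC; ring.
Qed.

(** Multiplied by c_(j+1), [tailS] becomes a recursion in j, since j c_(j+1) = (j - 'X) c_j. The 1
    yields the limit 1/(j - y); the sum is the error. *)
Lemma tailE m j : (0 < j)%N ->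
  (j%:R - 'X) * (c j * tail m j)
  = 1 - \sum_(l < j) (m.+1 + l)%:R^-1 *: (c l.+1 * ('X * rprod 1 m.+1)).
Proof.
case: j => // j _; elim: j => [|j IH].
  by rewrite mulrCA tailS big_ord_recl big_ord0 addr0 /= /rprod big_ord0 !mul1r.
rewrite mulrCA tailS big_ord_recr /= opprD addrA -IH mulrBr mulrCA.
rewrite addnS mulrA rprodNS // -!mul_polyC; ring.
Qed.

(** For i > 0 the coefficient is s^r times the elementary symmetric polynomial e_r of 1, 1/2, ...,
    1/(i-1), and e_r <= e_1^r. *)
Lemma coef_rprod s i r : `|s| <= 1 -> `|(rprod s i)`_r| <= harmonic_sum i ^+ r.
Proof.
move=> s1; case: i => [|i]; first by rewrite coef0 normr0 exprn_ge0 // harmonic_sum_ge0.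
apply: (@le_trans _ _ (harmonic_sum i ^+ r)); last first.
  by rewrite lerXn2r ?nnegrE ?harmonic_sum_ge0 // le_harmonic_sum.
elim: i r => [|i IH] r.
  rewrite /rprod big_ord0 coef1; case: r => [|r]; first by rewrite expr0 normr1.
  by rewrite normr0 exprn_ge0 // harmonic_sum_ge0.
have -> : rprod s i.+2 = rprod s i.+1 + (s / i.+1%:R) *: ('X * rprod s i.+1).
  by rewrite /rprod big_ord_recr /= mulrDr mulr1 -scalerAr (mulrC 'X).
rewrite coefD coefZ coefXM; case: r => [|r].
  by rewrite mulr0 addr0 expr0 (le_trans (IH _)) ?expr0.
apply: (@le_trans _ _ (harmonic_sum i ^+ r.+1 + harmonic_sum i ^+ r / i.+1%:R)).
  rewrite (le_trans (ler_normD _ _)) // lerD //= normrM mulrC.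
  apply: ler_pM => //; rewrite normrM normfV normr_nat.
  by rewrite ler_piMl // invr_ge0 ler0n.
rewrite [in leRHS]/harmonic_sum big_ord_recr /= -/(harmonic_sum i).
have h0 := harmonic_sum_ge0 i; have e0 : 0 <= i.+1%:R^-1 :> F by rewrite invr_ge0 ler0n.
rewrite [in leRHS]exprS mulrDl [in leLHS]exprS mulrC [_ / _]mulrC mulrC.
by apply: lerD; rewrite ler_wpM2l // lerXn2r ?nnegrE ?addr_ge0 // lerDl.
Qed.

Lemma coef_rprod_mul (L : F) m l r : 1 <= L ->
  harmonic_sum m.+1 <= L -> harmonic_sum l.+1 <= L ->
  `|(c l.+1 * ('X * rprod 1 m.+1))`_r| <= r.+1%:R * L ^+ r.
Proof.
move=> L1 mL lL; have L0 : 0 <= L by apply: le_trans L1.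
rewrite coefM (le_trans (ler_norm_sum _ _ _)) //.
rewrite -[r.+1 in leRHS]card_ord mulr_natl -sumr_const; apply: ler_sum => i _.
have ir : (i <= r)%N by rewrite -ltnS.
rewrite normrM -[in leRHS](subnKC ir) exprD.
apply: ler_pM => //.
  apply: le_trans (coef_rprod _ _ _) _; first by rewrite normrN normr1.
  by rewrite lerXn2r ?nnegrE // harmonic_sum_ge0.
rewrite coefXM; case: (r - i)%N => [|k] /=; first by rewrite normr0 ler01.
apply: le_trans (coef_rprod _ _ _) _; first by rewrite normr1.
apply: (@le_trans _ _ (L ^+ k)); last by rewrite exprS ler_peMl // exprn_ge0.
by rewrite lerXn2r ?nnegrE // harmonic_sum_ge0.
Qed.

(** Dividing [tailE] by j - y gives a recursion in r, which 1/j^(r+1) solves without the error term.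
    The errors add up by (r+2) + (r+1)^2 <= (r+2)^2. *)
Lemma coef_tail_bound (L : F) m j r : (0 < j)%N -> 1 <= L ->
  harmonic_sum m.+1 <= L -> harmonic_sum j <= L ->
  `|(c j * tail m j)`_r - j%:R^-1 ^+ r.+1| <= r.+1%:R ^+ 2 * L ^+ r / m.+1%:R.
Proof.
move=> j0 L1 mL jL; have L0 : 0 <= L by apply: le_trans L1.
have jn0 : j%:R != 0 :> F by rewrite pnatr_eq0 -lt0n.
have j1 : j%:R^-1 <= 1 :> F by rewrite invf_le1 ?ltr0n // ler1n.
have j0' : 0 <= j%:R^-1 :> F by rewrite invr_ge0 ler0n.
have m0 : 0 <= m.+1%:R^-1 :> F by rewrite invr_ge0 ler0n.
pose err := \sum_(l < j) (m.+1 + l)%:R^-1 *: (c l.+1 * ('X * rprod 1 m.+1)).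
(* The factor 1/j compensates the j summands of [err]. *)
have errB q : j%:R^-1 * `|err`_q| <= q.+1%:R * L ^+ q / m.+1%:R.
  rewrite ler_pdivrMl ?ltr0n // /err coef_sum (le_trans (ler_norm_sum _ _ _)) //.
  rewrite [leRHS]mulr_natl -[X in _ *+ X]card_ord -sumr_const; apply: ler_sum => l _.
  rewrite coefZ normrM normfV normr_nat [leLHS]mulrC; apply: ler_pM => //.
    by rewrite invr_ge0.
    by apply: coef_rprod_mul => //; apply: le_trans jL; apply: le_harmonic_sum.
  by rewrite lef_pV2 ?posrE ?ltr0n // ler_nat leq_addr.
have E q : (c j * tail m j)`_q = j%:R^-1 * ((q == 0%N)%:R - err`_q
    + if q is q'.+1 then (c j * tail m j)`_q' else 0).
  have := congr1 (fun p : {poly F} => p`_q) (tailE m j0).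
  rewrite -/err mulrBl -polyC_natr mul_polyC !coefB coefZ coefXM coef1.
  move=> H; apply: (mulfI jn0); rewrite mulrA mulfV // mul1r.
  by case: q H => [|q] /= <-; rewrite ?subr0 ?addr0 ?subrK.
elim: r => [|r IH].
  rewrite E addr0 expr1 mulrBr mulr1 addrAC subrr add0r normrN normrM.
  by rewrite ger0_norm // (le_trans (errB 0%N)) // expr1n.
rewrite E /= sub0r exprS -mulrBr normrM ger0_norm // -addrA.
rewrite (le_trans (ler_wpM2l j0' (ler_normD _ _))) // normrN mulrDr.
apply: le_trans (lerD (errB r.+1) (ler_wpM2r (normr_ge0 _) j1)) _.
rewrite mul1r; apply: le_trans (lerD (lexx _) IH) _.
rewrite -mulrDl ler_wpM2r //.
apply: (@le_trans _ _ (r.+2%:R * L ^+ r.+1 + r.+1%:R ^+ 2 * L ^+ r.+1)).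
  rewrite lerD2l ler_wpM2l ?exprn_ge0 ?ler0n //.
  by rewrite exprS ler_peMl // exprn_ge0.
rewrite -mulrDl ler_wpM2r ?exprn_ge0 // -!natrX -natrD ler_nat; lia.
Qed.

(** Partial fractions: 1/(j (M+1-j)) = (1/j + 1/(M+1-j)) / (M+1), and both parts have the same
    sum. *)
Lemma sum_inv_mul_rev M :
  \sum_(1 <= j < M.+1) j%:R^-1 / (M - j).+1%:R
  = harmonic_sum M * 2 / M.+1%:R :> F.
Proof.
have nz k : k.+1%:R != 0 :> F by rewrite pnatr_eq0.
rewrite big_add1 big_mkord /=.
transitivity (\sum_(l < M) (l.+1%:R^-1 + (rev_ord l).+1%:R^-1) / M.+1%:R : F).
  apply: eq_bigr => l _ /=; rewrite subnSK //.
  have -> : M.+1%:R = l.+1%:R + (M - l)%:R :> F by rewrite -natrD addSn subnKC // ltnW.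
  have y0 : (M - l)%:R != 0 :> F by rewrite -(subnSK (ltn_ord l)) nz.
  have s0 : l.+1%:R + (M - l)%:R != 0 :> F.
    by rewrite -natrD addSn nz.
  move: (nz l) y0 s0; move: (l.+1%:R) ((M - l)%:R) => x y x0 y0 s0.
  by field; rewrite s0 y0 x0.
have H : \sum_(l < M) (rev_ord l).+1%:R^-1 = harmonic_sum M.
  by rewrite [RHS](reindex_inj rev_ord_inj).
by rewrite -mulr_suml big_split /= H mulr_natr mulr2n.
Qed.

(** By [coef_tail_bound] with m = M - j the error for each j is at most 2 (n+1)^2 L^n / (j (M-j+1)),
    where 2 bounds |1 - t^j|. [sum_inv_mul_rev] supplies the other factor 2 and the last L. *)
Lemma Psum_bound (t : F) M n h : `|t| <= 1 ->
  `|Psum M t n.+1 h 0 - \sum_(1 <= j < M.+1) (1 - t ^+ j) / j%:R ^+ (n + h).+2|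
  <= 4 * n.+1%:R ^+ 2 * harmonic_sum M.+1 ^+ n.+1 / M.+1%:R.
Proof.
move=> t1; rewrite PsumE -sumrB.
set L := harmonic_sum M.+1; have L1 : 1 <= L by apply: harmonic_sum_ge1.
have L0 : 0 <= L by apply: le_trans L1.
have m0 k : 0 <= k%:R^-1 :> F by rewrite invr_ge0 ler0n.
apply: (@le_trans _ _ (\sum_(1 <= j < M.+1)
    2 * n.+1%:R ^+ 2 * L ^+ n * (j%:R^-1 / (M - j).+1%:R))); last first.
  rewrite -mulr_sumr sum_inv_mul_rev [L ^+ n.+1]exprSr.
  have : harmonic_sum M <= L by apply: le_harmonic_sum.
  move=> H; apply: (@le_trans _ _ (2 * n.+1%:R ^+ 2 * L ^+ n * (L * 2 / M.+1%:R))).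
    by rewrite ler_wpM2l ?mulr_ge0 ?exprn_ge0 ?ler0n // !ler_wpM2r.
  by rewrite le_eqVlt; apply/orP; left; apply/eqP; ring.
rewrite (le_trans (ler_norm_sum _ _ _)) // big_nat_cond [leRHS]big_nat_cond.
apply: ler_sum => j; rewrite andbT ltnS => /andP[j0 jM].
have -> : (1 - t ^+ j) / j%:R ^+ (n + h).+2 =
          (1 - t ^+ j) / j%:R ^+ h.+1 * j%:R^-1 ^+ n.+1.
  by rewrite -mulrA; congr (_ * _); rewrite exprVn -invfM -exprD addSn addnS addnC.
rewrite -mulrBr normrM.
have -> : 2 * n.+1%:R ^+ 2 * L ^+ n * (j%:R^-1 / (M - j).+1%:R)
        = (2 * j%:R^-1) * (n.+1%:R ^+ 2 * L ^+ n / (M - j).+1%:R) :> F by ring.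
apply: ler_pM => //.
  rewrite normrM; apply: ler_pM => //.
    rewrite (le_trans (ler_normB _ _)) // normr1 normrX.
    by rewrite lerD2l exprn_ile1.
  rewrite normfV normrX normr_nat exprS invfM ler_piMr // invf_le1 ?exprn_gt0 ?ltr0n //.
  by rewrite exprn_ege1 // ler1n.
by apply: coef_tail_bound => //; apply: le_harmonic_sum; lia.
Qed.

End Error.

(** * Sums over chains *)

Section FfunCons.
Variables (T : finType) (n : nat).

Definition ffun_cons (xg : T * {ffun 'I_n -> T}) : {ffun 'I_n.+1 -> T} :=
  [ffun i => if unlift ord0 i is Some j then xg.2 j else xg.1].

Lemma ffun_cons_bij : bijective ffun_cons.
Proof.
exists (fun f : {ffun 'I_n.+1 -> T} =>
  (f ord0, [ffun j : 'I_n => f (lift ord0 j)])) => [[x g]|f].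
  rewrite /ffun_cons ffunE unlift_none /=; congr (_, _).
  by apply/ffunP => j; rewrite !ffunE liftK.
apply/ffunP => i; rewrite ffunE /=.
by case: unliftP => [j|] ->; rewrite ?ffunE.
Qed.

Lemma codom_ffun_cons x g : codom (ffun_cons (x, g)) = x :: codom g.
Proof.
rewrite /codom /image_mem !enum_ordSl /= ffunE unlift_none -map_comp.
by congr (_ :: _); apply: eq_map => j; rewrite /= ffunE liftK.
Qed.

(** Predicate and summand act on the list of values, so that splitting off the first value is a
    plain [cons]. *)
Lemma sum_ffunS (V : nmodType) (P : pred (seq T)) (G : seq T -> V) :
  \sum_(f : {ffun 'I_n.+1 -> T} | P (codom f)) G (codom f) =
  \sum_x \sum_(g : {ffun 'I_n -> T} | P (x :: codom g)) G (x :: codom g).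
Proof.
rewrite (reindex ffun_cons) /=; last exact: onW_bij ffun_cons_bij.
rewrite pair_big_dep /=; apply: eq_big => [[x g]|[x g] _]; by rewrite codom_ffun_cons.
Qed.

End FfunCons.

Arguments sum_ffunS {T n V}.

Lemma sum_ffun0 (T : finType) (V : nmodType) (P : pred (seq T)) (G : seq T -> V) :
  \sum_(f : {ffun 'I_0 -> T} | P (codom f)) G (codom f) = if P [::] then G [::] else 0.
Proof.
have f0 : 'I_0 -> T by case.
rewrite (eq_bigl (fun f => P [::])) => [|f]; last first.
  by rewrite /codom /image_mem enum_ord0.
rewrite big_mkcond (big_pred1 (finfun f0)) => [|f]; last first.
  by apply/esym/eqP/ffunP => -[].
by rewrite /codom /image_mem enum_ord0.
Qed.

Section Chains.
Variable F : numFieldType.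
Implicit Types (t : F) (b : bool) (s : nat) (ks ms : seq nat).

(* The flag b records that all previous exponents are 1, s is the sum of the previous
   summation variables, and the entries of ms are the next ones minus 1. *)
Fixpoint chain_term t b s ks ms : F :=
  if ks is k :: ks' then if ms is m :: ms' then
    (if b then 1 - t ^+ m.+1 else 1) / (s + m.+1)%:R ^+ k
      * chain_term t (b && (k == 1)%N) (s + m.+1) ks' ms'
  else 1 else 1.

Lemma chain_term_ge0 t s ks ms : 0 <= chain_term t false s ks ms.
Proof.
elim: ks ms s => [|k ks IH] [|m ms] s //=; try exact: ler01.
by rewrite mulr_ge0 ?IH // div1r invr_ge0 exprn_ge0 // ler0n.
Qed.

Lemma chain_term_norm t b s ks ms : `|t| <= 1 ->
  `|chain_term t b s ks ms| <= 2 ^+ size ms * chain_term t false s ks ms.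
Proof.
move=> t1; elim: ks ms b s => [|k ks IH] ms b s.
  by rewrite [chain_term _ _ _ _ _]/= normr1 mulr1 exprn_ege1 // ler1n.
case: ms => [|m ms]; first by rewrite /= normr1 mul1r.
rewrite /= normrM normrM normfV normrX normr_nat [2 ^+ _.+1]exprS.
rewrite [leRHS](_ : _ = 2 / (s + m.+1)%:R ^+ k *
  (2 ^+ size ms * chain_term t false (s + m.+1) ks ms)); last by ring.
apply: ler_pM => //; first by rewrite divr_ge0 // exprn_ge0 // ler0n.
rewrite ler_wpM2r // ?invr_ge0 ?exprn_ge0 ?ler0n //.
case: b; last by rewrite normr1 ler1n.
rewrite (le_trans (ler_normB _ _)) // normr1 normrX.
by rewrite lerD2l exprn_ile1.
Qed.

(** The conditions of I(1) for weight e; the default 0 of [last] excludes the empty list. *)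
Definition admissible (e : nat) ks :=
  [&& all (leq 1) ks, (1 < last 0 ks)%N & sumn ks == e].

Lemma admissible_gt e ks : admissible e ks -> (size ks < e)%N.
Proof.
case/and3P => + + /eqP <-; elim: ks => [//|k [|l ks] IH] /=.
  by rewrite addn0.
by case/andP => k0 /IH /[apply] /=; lia.
Qed.

Lemma admissible_cons e k l ks :
  admissible e (k :: l :: ks) = (0 < k <= e)%N && admissible (e - k)%N (l :: ks).
Proof.
have E S : (k + S == e)%N = (k <= e)%N && (S == e - k)%N by lia.
rewrite /admissible /= E.
by case: (0 < k)%N; case: (k <= e)%N => //=; rewrite ?andbF.
Qed.

Variables (M K : nat).

(** P is arbitrary because splitting off a first exponent x replaces it by P (x :: ks), while the
    type of the exponents stays fixed. *)
Definition Zsum t b n (P : pred (seq nat)) s : F :=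
  \sum_(kk : {ffun 'I_n -> 'I_K} | P [seq val k | k <- codom kk])
  \sum_(m : {ffun 'I_n -> 'I_M} |
          (s + sumn [seq (val i).+1 | i <- codom m] <= M)%N)
    chain_term t b s [seq val k | k <- codom kk] [seq val i | i <- codom m].

Lemma Zsum0 t b P s : (s <= M)%N -> Zsum t b 0 P s = (P [::])%:R.
Proof.
move=> sM; rewrite /Zsum.
rewrite (sum_ffun0 (fun kk => P [seq val k | k <- kk])
  (fun kk => \sum_(m : {ffun 'I_0 -> 'I_M} |
          (s + sumn [seq (val i).+1 | i <- codom m] <= M)%N)
    chain_term t b s [seq val k | k <- kk] [seq val i | i <- codom m])) /=.
case: ifP => // _.
rewrite (sum_ffun0 (fun m => (s + sumn [seq (val i).+1 | i <- m] <= M)%N) (fun=> 1)) /=.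
by rewrite addn0 sM.
Qed.

Lemma eq_Zsum t b n P Q s : (forall ks, size ks = n -> P ks = Q ks) ->
  Zsum t b n P s = Zsum t b n Q s.
Proof.
move=> PQ; apply: eq_bigl => kk; apply: PQ.
by rewrite size_map size_codom card_ord.
Qed.

Lemma Zsum_pred0 t b n P s : (forall ks, size ks = n -> P ks = false) ->
  Zsum t b n P s = 0.
Proof. by move=> P0; rewrite (@eq_Zsum t b n P xpred0) // /Zsum big_pred0. Qed.

Lemma sum_shift_le (g : nat -> nat -> F) s :
  \sum_(i < M | (s + i.+1 <= M)%N) g i (s + i.+1)%N =
  \sum_(s.+1 <= a < M.+1) g (a - s).-1 a.
Proof.
rewrite big_add1 -[in index_iota s _](add0n s) big_addn /=.
rewrite -(big_mkord (fun i => (s + i.+1 <= M)%N) (fun i => g i (s + i.+1)%N)).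
rewrite [RHS](big_nat_widen _ _ M) ?leq_subr //= big_nat_cond [RHS]big_nat_cond.
apply: eq_big => i; first by lia.
by move=> _; rewrite -addSn addnK addnC.
Qed.

Lemma ZsumS t b n P s :
  Zsum t b n.+1 P s = \sum_(s.+1 <= a < M.+1) (if b then 1 - t ^+ (a - s) else 1) *
    \sum_(x < K) Zsum t (b && (val x == 1)%N) n (fun ks => P (val x :: ks)) a / a%:R ^+ x.
Proof.
transitivity (\sum_(x < K) \sum_(i < M | (s + i.+1 <= M)%N)
    (if b then 1 - t ^+ i.+1 else 1) / (s + i.+1)%:R ^+ x *
     Zsum t (b && (val x == 1)%N) n (fun ks => P (val x :: ks)) (s + i.+1)).
  rewrite /Zsum (sum_ffunS (fun kk => P [seq val k | k <- kk])
    (fun kk => \sum_(m : {ffun 'I_n.+1 -> 'I_M} |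
          (s + sumn [seq (val i).+1 | i <- codom m] <= M)%N)
    chain_term t b s [seq val k | k <- kk] [seq val i | i <- codom m])).
  apply: eq_bigr => x _.
  under [RHS]eq_bigr => i _ do rewrite mulr_sumr.
  rewrite [RHS]exchange_big /=; apply: eq_bigr => kk _.
  rewrite (sum_ffunS (fun m => (s + sumn [seq (val i).+1 | i <- m] <= M)%N)
    (fun m => chain_term t b s (val x :: [seq val k | k <- codom kk]) [seq val i | i <- m])).
  rewrite [RHS]big_mkcond; apply: eq_bigr => i _ /=.
  case: leqP => siM; last first.
    rewrite big_pred0 // => m; apply/negbTE; rewrite -ltnNge addnA.
    by rewrite (leq_trans siM) // leq_addr.
  by rewrite mulr_sumr; apply: eq_bigl => m; rewrite addnA.
rewrite exchange_big /=.
pose g i a : F := (if b then 1 - t ^+ i.+1 else 1) *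
  \sum_(x < K) Zsum t (b && (val x == 1)%N) n (fun ks => P (val x :: ks)) a / a%:R ^+ x.
transitivity (\sum_(i < M | (s + i.+1 <= M)%N) g i (s + i.+1)%N).
  apply: eq_bigr => i _; rewrite /g mulr_sumr; apply: eq_bigr => x _.
  by rewrite -mulrA [_^-1 * _]mulrC.
rewrite (sum_shift_le g); apply: eq_big_nat => a /andP[sa _].
by rewrite /g prednK // subn_gt0.
Qed.

(** A first exponent i + 1 contributes 1/a^(i+1) and leaves h - i of the excess h, so summing over
    it gives [xdiv]. Only i = 0 keeps a raised flag, hence the separate term in [Psum]. *)
Lemma Zsum_admissible t b n h s : (n + h.+2 < K)%N ->
  Zsum t b n.+1 (admissible (n + h.+2)) s =
  if b then Psum M t n.+1 h s else Tsum F M n.+1 h s.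
Proof.
elim: n b h s => [|n IH] b h s hK; rewrite ZsumS.
  transitivity (\sum_(s.+1 <= a < M.+1) (if b then 1 - t ^+ (a - s) else 1) / a%:R ^+ h.+2).
    rewrite big_nat_cond [RHS]big_nat_cond; apply: eq_bigr => a.
    rewrite andbT => /andP[_ aM]; congr (_ * _).
    rewrite (bigD1 (Ordinal hK)) //= [X in _ + X]big1 ?addr0 => [|x xK].
      by rewrite Zsum0 // /admissible /= !addn0 eqxx mul1r.
    rewrite Zsum0 // /admissible /= addn0; case: eqP => [xh|]; last by rewrite !andbF mul0r.
    by case/eqP: xK; apply: val_inj.
  have E a : xdiv (Tsum F M 0) h a = 1 / a%:R ^+ h.+2 :> F.
    rewrite /xdiv big_ord_recr /= subnn big1 => [|i _].
      by rewrite add0r -mulrA -invfM -exprS.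
    by rewrite subn_eq0 leqNgt ltn_ord !mul0r.
  case: b; apply: eq_bigr => a _; last by rewrite E.
  by rewrite E /= [X in _ = _ * X]addrC subrK div1r.
have E a : \sum_(x < K) Zsum t (b && (val x == 1)%N) n.+1
    (fun ks => admissible (n.+1 + h.+2) (val x :: ks)) a / a%:R ^+ x =
  \sum_(i < h.+1) (if b && (i == 0 :> nat) then Psum M t n.+1 (h - i) a
     else Tsum F M n.+1 (h - i) a) / a%:R ^+ i.+1.
  pose G x := Zsum t (b && (x == 1)%N) n.+1
    (fun ks => admissible (n.+1 + h.+2) (x :: ks)) a / a%:R ^+ x.
  (* An exponent x >= h + 2 would leave at most n + 1 for n + 1 entries, against [admissible_gt]; x
     = 0 is not positive. *)
  rewrite -(big_mkord xpredT G) (big_cat_nat (n := h.+2)) //; last by lia.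
  rewrite [LHS]/= [X in _ + X]big_nat_cond [X in _ + X]big1 => [|x]; last first.
    rewrite andbT => /andP[hx _]; rewrite /G Zsum_pred0 ?mul0r // => -[//|k ks] [sks].
    rewrite admissible_cons; apply/negbTE/negP => /andP[/andP[x0 _]].
    by move/admissible_gt => /=; rewrite sks; lia.
  rewrite addr0 big_mkord big_ord_recl {1}/G Zsum_pred0 // mul0r add0r.
  apply: eq_bigr => i _; rewrite /G lift0; congr (_ / _).
  rewrite -(IH _ (h - i)%N); last by lia.
  apply: eq_Zsum => -[//|k ks] _; rewrite admissible_cons.
  have ih : (i <= h)%N by rewrite -ltnS.
  rewrite (_ : (0 < i.+1 <= n.+1 + h.+2)%N) ?andTb; last by lia.
  by congr admissible; lia.
under eq_bigr => a _ do rewrite E.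
case: b {IH E} => /=; apply: eq_bigr => a _; last by rewrite mul1r.
congr (_ * _); rewrite big_ord_recl /= subn0; congr (_ + _).
rewrite {2}/xdiv big_ord_recl subn0 expr1 addrAC subrr add0r.
by apply: eq_bigr => i _; rewrite /= /bump add1n.
Qed.

End Chains.

(** * Unconditional sums of complex families *)

Section NetSums.
Variables (I : choiceType) (R : realType).

Lemma partial_sumE (V : zmodType) (f : I -> V) (A : {fset I}) :
  partial_sum f A = \sum_(i <- A) f i.
Proof. by rewrite /partial_sum big_seq_fsetE. Qed.

Lemma le_partial_sum (K : numDomainType) (f : I -> K) (A B : {fset I}) :
  (forall i, 0 <= f i) -> (A `<=` B)%fset -> partial_sum f A <= partial_sum f B.
Proof.
move=> f0 AB; rewrite !partial_sumE [leRHS](big_fsetID _ (mem A)) /=.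
rewrite [X in X + _](_ : _ = \sum_(i <- A) f i).
  by rewrite lerDl sumr_ge0.
apply: eq_fbigl => i; rewrite !inE /= andbC; case: (boolP (i \in A)) => //= iA.
by rewrite (fsubsetP AB).
Qed.

Lemma is_cvg_nneg_partial_sum (f : I -> R) (B : R) : (forall i, 0 <= f i) ->
  (forall A : {fset I}, partial_sum f A <= B) ->
  exists l : R, partial_sum f @ totally --> l.
Proof.
move=> f0 fB; pose S := range (partial_sum f).
have supS : has_sup S.
  by split; [exists (partial_sum f fset0), fset0 | exists B => _ [A _ <-]].
exists (sup S); apply/cvgrPdist_lt => e e0.
have [_ [A _ <-] AS] := sup_adherent e0 supS.
exists A => // C /= AC.
have CS : partial_sum f C <= sup S by apply: sup_upper_bound => //; exists C.
rewrite ger0_norm ?subr_ge0 // ltrBlDr -ltrBlDl (lt_le_trans AS) //.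
exact: le_partial_sum.
Qed.

(** f is the difference of the nonnegative families |f| + f and |f|. *)
Lemma is_cvg_real_partial_sum (f : I -> R) (B : R) :
  (forall A : {fset I}, partial_sum (fun i => `|f i|) A <= B) ->
  exists l : R, partial_sum f @ totally --> l.
Proof.
move=> fB.
have [l1 f1] : exists l : R, partial_sum (fun i => `|f i| + f i) @ totally --> l.
  apply: (@is_cvg_nneg_partial_sum _ (B + B)) => [i|A].
    by rewrite -lerBlDl sub0r lerNnormlW.
  apply: le_trans (lerD (fB A) (fB A)); rewrite /partial_sum -big_split /=.
  by apply: ler_sum => i _; rewrite lerD2l ler_norm.
have [l2 f2] := is_cvg_nneg_partial_sum (fun i => normr_ge0 (f i)) fB.
exists (l1 - l2).
have -> : partial_sum f = partial_sum (fun i => `|f i| + f i) - partial_sum (fun i => `|f i|).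
  apply/funext => A; rewrite /partial_sum !fctE -sumrB; apply: eq_bigr => i _.
  by rewrite addrC addKr.
exact: cvgB.
Qed.

End NetSums.

Section ComplexLimits.
Variable R : realType.

(** The radii in the topology of [R[i]^o] are positive complex numbers, hence real. *)
Lemma gt0_complexE (e : R[i]) : 0 < e -> exists2 e' : R, 0 < e' & e = e'%:C%C.
Proof.
by case: e => a b; rewrite ltcE /= => /andP[/eqP -> a0]; exists a.
Qed.

Lemma cvg_complex_dist (T : Type) (G : set_system T) (FG : Filter G)
    (f : T -> R[i]^o) (l : R[i]^o) (u : T -> R) :
  (forall x, `|f x - l| <= (u x)%:C%C) -> u @ G --> 0 -> f @ G --> l.
Proof.
move=> fu u0; apply/cvgrPdist_lt => e /gt0_complexE[e' e'0 ->].
move/cvgrPdist_lt : u0 => /(_ _ e'0); apply: filterS => x.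
rewrite sub0r normrN => ux; rewrite distrC (le_lt_trans (fu x)) // ltcR.
exact: le_lt_trans (ler_norm _) ux.
Qed.

Lemma cvg_complex (T : Type) (G : set_system T) (FG : Filter G)
    (f : T -> R[i]^o) (a b : R) :
  (fun x => complex.Re (f x)) @ G --> a -> (fun x => complex.Im (f x)) @ G --> b ->
  f @ G --> ((a +i* b)%C : R[i]^o).
Proof.
move=> fa fb; pose u x := `|complex.Re (f x) - a| + `|complex.Im (f x) - b|.
apply: (@cvg_complex_dist _ _ _ _ _ u).
  move=> x; rewrite /u rmorphD /=; case: (f x) => p q /=.
  have -> : (p +i* q)%C - (a +i* b)%C = (p - a)%:C%C + 'i%C * (q - b)%:C%C.
    by rewrite [LHS]complexE.
  rewrite (le_trans (ler_normD _ _)) // normrM !normc_def /=.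
  by rewrite !expr0n /= !addr0 add0r expr1n sqrtr1 mul1r !sqrtr_sqr.
have dist0 (g : T -> R) x : g @ G --> x -> (fun y => `|g y - x|) @ G --> (0 : R).
  move=> gx; rewrite -[0](@normr0 _ R) -(subrr x).
  by apply: cvg_norm; apply: cvgB => //; exact: cvg_cst.
by rewrite -[0]addr0; apply: cvgD; exact: dist0.
Qed.

Lemma is_cvg_partial_sum (I : choiceType) (f : I -> R[i]^o) (B : R) :
  (forall A : {fset I}, partial_sum (fun i => `|f i|) A <= B%:C%C) ->
  cvg (partial_sum f @ totally).
Proof.
move=> fB.
have H (p : R[i] -> R) : (forall z, `|p z|%:C%C <= `|z|) ->
    exists l : R, partial_sum (fun i => p (f i)) @ totally --> l.
  move=> pz; apply: (@is_cvg_real_partial_sum _ _ _ B) => A.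
  rewrite -lecR; apply: le_trans (fB A); rewrite /partial_sum rmorph_sum.
  by apply: ler_sum => i _; exact: pz.
have [a fa] := H _ (@normc_ge_Re R).
have [|b fb] := H (@complex.Im R).
  move=> [p q]; rewrite normc_def lecR /= -(sqrtr_sqr q) ler_sqrt ?lerDr ?sqr_ge0 //.
  by rewrite addr_ge0 ?sqr_ge0.
apply/cvg_ex; exists ((a +i* b)%C : R[i]^o); apply: cvg_complex.
  rewrite (_ : (fun A => _) = partial_sum (fun i => complex.Re (f i))) //.
  by apply/funext => A; rewrite /partial_sum raddf_sum.
rewrite (_ : (fun A => _) = partial_sum (fun i => complex.Im (f i))) //.
by apply/funext => A; rewrite /partial_sum raddf_sum.
Qed.

End ComplexLimits.

Lemma cvg_exhaustion (I : choiceType) (A : nat -> {fset I}) :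
  (forall i, \forall M \near \oo, i \in A M) -> A @ \oo --> @totally I.
Proof.
move=> AP P [B _ BP]; rewrite /= nbhs_filterE.
suff : \forall M \near \oo, (B `<=` A M)%fset by apply: filterS => M; exact: BP.
have : \forall M \near \oo, forall i : B, val i \in A M.
  by apply: filter_forall => i; exact: AP.
by apply: filterS => M BA; apply/fsubsetP => i iB; exact: (BA [` iB]%fset).
Qed.

(** * Growth of powers of the harmonic sum *)

Section HarmonicGrowth.
Variable F : numFieldType.

Lemma exprD_le (a e : F) q : 0 <= a -> 0 <= e ->
  (a + e) ^+ q.+1 <= a ^+ q.+1 + q.+1%:R * e * (a + e) ^+ q.
Proof.
move=> a0 e0; elim: q => [|q IH]; first by rewrite !expr1 expr0 mulr1 mul1r.
have ae0 : 0 <= a + e by rewrite addr_ge0.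
rewrite exprS; apply: le_trans (ler_wpM2l ae0 IH) _.
rewrite mulrDr mulrDl -exprS -addrA lerD2l mulrCA -exprS.
rewrite -(natr1 q.+1) [(q.+1%:R + 1) * e]mulrDl mul1r mulrDl addrC lerD2l.
by rewrite ler_wpM2l // lerXn2r ?nnegrE // lerDl.
Qed.

(** By [exprD_le] and the bound for q, each step in n increases the power q + 1 by at most (q+1) q!
    = (q+1)!. *)
Lemma harmonic_sum_exp_le q n : harmonic_sum F n.+1 ^+ q <= q`!%:R * n.+1%:R.
Proof.
elim: q n => [|q IH] n; first by rewrite expr0 mul1r ler1n.
elim: n => [|n IHn].
  by rewrite /harmonic_sum big_ord_recl big_ord0 invr1 addr0 expr1n mulr1 ler1n fact_gt0.
have e0 : 0 <= n.+2%:R^-1 :> F by rewrite invr_ge0 ler0n.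
have hS : harmonic_sum F n.+2 = harmonic_sum F n.+1 + n.+2%:R^-1.
  by rewrite {1}/harmonic_sum big_ord_recr.
rewrite hS; apply: le_trans (exprD_le _ (harmonic_sum_ge0 _ _) e0) _; rewrite -hS.
apply: le_trans (lerD IHn (ler_wpM2l _ (IH n.+1))) _; first by rewrite mulr_ge0 ?ler0n.
have n0 : n.+2%:R != 0 :> F by rewrite pnatr_eq0.
rewrite mulrACA mulVf // mulr1 -(natrM _ q.+1) -factS.
by rewrite -[n.+2%:R in leRHS]natr1 mulrDr mulr1.
Qed.

End HarmonicGrowth.

Section Limits.
Variable R : realType.

(** By [harmonic_sum_exp_le] with exponent 2q, the square is at most (2q)! / (M+1). *)
Lemma cvg_harmonic_exp q : (fun M => harmonic_sum R M.+1 ^+ q / M.+1%:R) @ \oo --> 0.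
Proof.
apply/cvgrPdist_lt => e e0; have := @cvg_harmonic R.
move/cvgrPdist_lt => /(_ (e ^+ 2 / (q + q)`!%:R)).
rewrite divr_gt0 ?exprn_gt0 ?ltr0n ?fact_gt0 // => /(_ isT).
apply: filterS => M; rewrite !sub0r !normrN /harmonic /=.
have m0 : 0 < M.+1%:R :> R by rewrite ltr0n.
have h0 := harmonic_sum_ge0 R M.+1.
rewrite !ger0_norm ?invr_ge0 ?divr_ge0 ?exprn_ge0 ?(ltW m0) // => H.
rewrite -(@ltr_pXn2r _ 2%N) ?nnegrE ?divr_ge0 ?exprn_ge0 ?(ltW m0) ?(ltW e0) //.
rewrite expr_div_n -exprM muln2 -addnn.
apply: le_lt_trans (ler_wpM2r _ (harmonic_sum_exp_le R (q + q) M)) _.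
  by rewrite invr_ge0 exprn_ge0 // ltW.
rewrite expr2 invfM mulrA mulfK ?gt_eqF //.
by rewrite mulrC -ltr_pdivlMr // ltr0n fact_gt0.
Qed.

Lemma harmonic_sum_complex n : harmonic_sum R[i] n = (harmonic_sum R n)%:C%C.
Proof.
by rewrite /harmonic_sum rmorph_sum; apply: eq_bigr => l _; rewrite fmorphV rmorph_nat.
Qed.

Lemma cvg_Psum_dist n h (t : R[i]) : `|t| <= 1 ->
  (fun M => Psum M t n.+1 h 0
     - \sum_(1 <= j < M.+1) (1 - t ^+ j) / j%:R ^+ (n + h).+2 : R[i]^o) @ \oo --> (0 : R[i]^o).
Proof.
move=> t1; apply: (@cvg_complex_dist R _ _ _ _ _ (fun M : nat =>
  4 * n.+1%:R ^+ 2 * (harmonic_sum R M.+1 ^+ n.+1 / M.+1%:R))).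
  move=> M; rewrite subr0; apply: le_trans (Psum_bound _ _ _ t1) _.
  rewrite harmonic_sum_complex !rmorphM !rmorphXn !rmorph_nat fmorphV rmorph_nat.
  by rewrite !mulrA.
rewrite -[X in _ --> X](mulr0 (4 * n.+1%:R ^+ 2)).
by apply: cvgMr; exact: cvg_harmonic_exp.
Qed.

End Limits.

(** * The index sets *)

(** Positions count from 0: an admissible list lies in I'(r) exactly for r = [first_big] + 1. *)
Definition first_big (ks : seq nat) := find (predC1 1%N) ks.

Lemma leq_first_big ks j : (j <= size ks)%N ->
  (j <= first_big ks)%N = all (pred1 1%N) (take j ks).
Proof.
move=> jks; apply/idP/(all_nthP 0%N) => [jf i|H].
  rewrite size_take_min => /[!ltn_min] /andP[ij _]; rewrite nth_take //.
  by have := before_find 0%N (leq_trans ij jf); move/negbFE.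
rewrite leqNgt; apply/negP => fj.
have fks : has (predC1 1%N) ks by rewrite has_find (leq_trans fj).
have := nth_find 0%N fks; rewrite -/(first_big ks) /= => /eqP; apply.
have := H (first_big ks); rewrite size_takel // nth_take // => /(_ fj)/eqP; exact.
Qed.

Lemma first_big_lt e ks : admissible e ks -> (first_big ks < size ks)%N.
Proof.
case/and3P => _ l1 _; rewrite -has_find; apply/hasP.
exists (last 0%N ks); last by rewrite /= gtn_eqF.
by case: ks l1 => //= k ks _; rewrite mem_last.
Qed.

Section Values.
Variables (n K : nat).
Implicit Type f : {ffun 'I_n -> 'I_K}.

Definition vals f : seq nat := [seq val x | x <- codom f].

Lemma size_vals f : size (vals f) = n.
Proof. by rewrite size_map size_codom card_ord. Qed.

Lemma nth_vals f (i : 'I_n) : nth 0%N (vals f) i = f i.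
Proof.
rewrite /vals /codom /image_mem -map_comp (nth_map i) ?size_enum_ord //=.
by rewrite nth_ord_enum.
Qed.

Lemma all_take_vals (P : pred nat) f j :
  all P (take j (vals f)) = [forall i : 'I_n, (i < j)%N ==> P (f i)].
Proof.
apply/(all_nthP 0%N)/forallP => H i.
  apply/implyP => ij; rewrite -nth_vals -(nth_take _ ij) H //.
  by rewrite size_take_min size_vals ltn_min ij ltn_ord.
rewrite size_take_min size_vals ltn_min => /andP[ij i_n].
by rewrite nth_take // (nth_vals f (Ordinal i_n)) (implyP (H _)).
Qed.

Lemma sumn_vals f : sumn (vals f) = (\sum_(i < n) f i)%N.
Proof. by rewrite sumnE big_map big_map big_enum. Qed.

End Values.

Lemma mem_index_set n k r (kk : {ffun 'I_n -> 'I_k.+1}) : (0 < n)%N ->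
  (kk \in index_set n k r) =
  [&& (r <= n)%N, admissible k (vals kk) & (r.-1 <= first_big (vals kk))%N].
Proof.
move=> n0; rewrite /index_set; case: leqP => rn; last by rewrite inE.
rewrite inE /= leq_first_big ?size_vals; last by lia.
rewrite all_take_vals /admissible sumn_vals -!andbA; congr [&& _, _, _ & _].
  rewrite -[vals kk]take_size all_take_vals size_vals.
  by apply: eq_forallb => i; rewrite ltn_ord.
case: n n0 kk rn => // n _ kk rn.
rewrite -nth_last size_vals (nth_vals kk ord_max).
apply/forallP/idP => [/(_ ord_max)|H i]; first by rewrite eqxx.
by apply/implyP => /eqP[i_n]; rewrite (_ : i = ord_max) //; apply: val_inj.
Qed.

Lemma mem_index_set' n k r (kk : {ffun 'I_n -> 'I_k.+1}) : (0 < r <= n)%N ->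
  (kk \in index_set' n k r) =
  admissible k (vals kk) && (r == (first_big (vals kk)).+1).
Proof.
move=> /andP[r0 rn]; have n0 : (0 < n)%N by apply: leq_trans rn.
rewrite finset.in_setD !mem_index_set // rn /=.
case A : (admissible _ _); rewrite ?andbF //=.
have := first_big_lt A; rewrite size_vals; lia.
Qed.

Lemma mkseqS (T : Type) (f : nat -> T) n : mkseq f n.+1 = f 0%N :: mkseq (f \o succn) n.
Proof. by rewrite /mkseq /= -[1%N]addn0 iotaDl -map_comp. Qed.

Lemma chain_termE (F : numFieldType) (t : F) b s (k m : nat -> nat) n :
  chain_term t b s (mkseq k n) (mkseq m n) =
  \prod_(i < n) ((if b && all (pred1 1%N) (mkseq k i) then 1 - t ^+ (m i).+1 else 1)
    / (s + \sum_(j < i.+1) (m j).+1)%:R ^+ k i).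
Proof.
elim: n b s k m => [|n IH] b s k m; first by rewrite big_ord0.
rewrite 2!mkseqS [LHS]/= IH big_ord_recl; congr (_ * _).
  by rewrite /= andbT big_ord_recl big_ord0 addn0.
apply: eq_bigr => i _; rewrite lift0 mkseqS [all _ (_ :: _)]/= andbA.
by rewrite [in RHS]big_ord_recl addnA.
Qed.

(** The flag of [chain_term] is raised at position i when the first i exponents are 1, that is, when
    i <= [first_big] = r - 1. *)
Lemma multi_termE (R : realType) n k r (t : R[i]) (kk : {ffun 'I_n -> 'I_k.+1})
    (m : {ffun 'I_n -> nat}) : (r <= n)%N -> r = (first_big (vals kk)).+1 ->
  multi_term r t kk m = chain_term t true 0 (vals kk) (codom m).
Proof.
move=> rn rE.
have mE : codom m = mkseq (nth 0%N (codom m)) n.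
  by rewrite -[LHS](mkseq_nth 0%N) size_codom card_ord.
have mi (i : 'I_n) : nth 0%N (codom m) i = m i.
  by rewrite /codom /image_mem (nth_map i) ?size_enum_ord // nth_ord_enum.
rewrite mE -[vals kk](mkseq_nth 0%N) size_vals chain_termE big_split /= prodfV.
rewrite /multi_term; congr (_ / _).
  rewrite big_mkcond; apply: eq_bigr => i _ /=.
  have ik : (i <= size (vals kk))%N by rewrite size_vals ltnW.
  by rewrite mi /mkseq map_nth_iota0 // -leq_first_big // rE ltnS.
apply: eq_bigr => i _; rewrite nth_vals; congr (_%:R ^+ _); rewrite add0n.
rewrite (big_ord_widen n (fun j => (nth 0%N (codom m) j).+1)) //.
by apply: eq_big => j; rewrite ?ltnS // => _; rewrite mi.
Qed.

(** * Convergence *)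

Section Bounds.
Variable F : numFieldType.

Lemma sum_inv_sqr_le M : \sum_(l < M) (l.+1%:R ^+ 2)^-1 <= 2 :> F.
Proof.
case: M => [|M]; first by rewrite big_ord0.
(* Strengthened for induction: 1/(M+2)^2 <= 1/(M+1) - 1/(M+2). *)
suff : \sum_(l < M.+1) (l.+1%:R ^+ 2)^-1 <= 2 - M.+1%:R^-1 :> F.
  by move/le_trans; apply; rewrite gerBl invr_ge0 ler0n.
elim: M => [|M IH]; first by rewrite big_ord_recl big_ord0 expr1n invr1 addr0 addrK.
rewrite big_ord_recr /= -lerBrDr (le_trans IH) //.
rewrite -[leRHS]addrA lerD2l -opprD lerN2.
have nz k : k.+1%:R != 0 :> F by rewrite pnatr_eq0.
have -> : M.+1%:R^-1 = M.+2%:R^-1 + (M.+1%:R * M.+2%:R)^-1 :> F.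
  have := nz M; have := nz M.+1; rewrite -(natr1 M.+1); move: (M.+1%:R) => x.
  by move=> x1 x0; field; rewrite x0 x1.
rewrite lerD2l lef_pV2 ?posrE ?exprn_gt0 ?mulr_gt0 ?ltr0n //.
by rewrite expr2 ler_wpM2r // ler_nat.
Qed.

Lemma sum_inv_exp_le M e : \sum_(l < M) (l.+1%:R ^+ e.+2)^-1 <= 2 :> F.
Proof.
apply: le_trans (sum_inv_sqr_le M); apply: ler_sum => l _.
rewrite lef_pV2 ?posrE ?exprn_gt0 ?ltr0n //.
by rewrite ler_weXn2l // ler1n.
Qed.

Lemma Psum0 M n h s : Psum M 0 n h s = Tsum F M n h s.
Proof.
elim: n h s => [//|n IH] h s /=; apply: eq_big_nat => a /andP[sa _].
by rewrite expr0n subn_eq0 leqNgt sa subr0 mul1r IH addrC subrK.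
Qed.

(** At t = 0 [Psum_bound] compares [Tsum] with a truncated zeta sum, at most 2; the factorial bounds
    H_(M+1)^(n+1) / (M+1). *)
Lemma Tsum_le M n h :
  `|Tsum F M n.+1 h 0| <= (2 + 4 * n.+1 ^ 2 * n.+1`!)%N%:R.
Proof.
rewrite -Psum0; set S := \sum_(1 <= j < M.+1) (1 - 0 ^+ j) / j%:R ^+ (n + h).+2 : F.
rewrite -[Psum _ _ _ _ _](subrK S) addrC natrD.
apply: le_trans (ler_normD _ _) (lerD _ _).
  rewrite /S big_add1 big_mkord; apply: le_trans (ler_norm_sum _ _ _) _.
  apply: le_trans (sum_inv_exp_le M (n + h)); apply: ler_sum => l _.
  by rewrite expr0n subr0 mul1r normfV normrX normr_nat.
apply: le_trans (Psum_bound _ _ _ _) _; first by rewrite normr0.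
rewrite natrM [(4 * _)%:R]natrM natrX -mulrA.
apply: ler_wpM2l; first by rewrite mulr_ge0 ?exprn_ge0.
by rewrite ler_pdivrMr ?ltr0n //; exact: harmonic_sum_exp_le.
Qed.

End Bounds.

Section Boxes.
Variable n : nat.

Definition ffun_val M (m : {ffun 'I_n -> 'I_M}) : {ffun 'I_n -> nat} :=
  [ffun i => val (m i)].

Lemma ffun_val_inj M : injective (@ffun_val M).
Proof.
by move=> f g /ffunP fg; apply/ffunP => i; apply: val_inj; have := fg i; rewrite !ffunE.
Qed.

Lemma codom_ffun_val M (m : {ffun 'I_n -> 'I_M}) :
  codom (ffun_val m) = [seq val i | i <- codom m].
Proof.
rewrite /codom /image_mem -[RHS]map_comp.
by apply: eq_map => i; rewrite /= ffunE.
Qed.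

(** The simplex s_n <= M; [0 +] makes its condition that of [Zsum] at s = 0. *)
Definition box M : {fset {ffun 'I_n -> nat}} :=
  [fset ffun_val m | m in [pred m : {ffun 'I_n -> 'I_M} |
     (0 + sumn [seq (val i).+1 | i <- codom m] <= M)%N]]%fset.

Lemma partial_sum_box (V : zmodType) (f : {ffun 'I_n -> nat} -> V) M :
  partial_sum f (box M) = \sum_(m : {ffun 'I_n -> 'I_M} |
     (0 + sumn [seq (val i).+1 | i <- codom m] <= M)%N) f (ffun_val m).
Proof.
rewrite partial_sumE /box big_imfset /=; last by move=> x y _ _; exact: ffun_val_inj.
by rewrite big_enum.
Qed.

Lemma mem_box (m : {ffun 'I_n -> nat}) M :
  (\sum_(i < n) (m i).+1 <= M)%N -> m \in box M.
Proof.
move=> mM.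
have lt_mM i : (m i < M)%N.
  by apply: leq_trans mM; rewrite (bigD1 i) //= leq_addr.
have mE : m = ffun_val [ffun i => Ordinal (lt_mM i)].
  by apply/ffunP => i; rewrite !ffunE.
rewrite mE; apply: in_imfset; rewrite -topredE /= add0n sumnE 2!big_map big_enum /=.
by apply: leq_trans mM; apply: leq_sum => i _; rewrite ffunE.
Qed.

Lemma near_mem_box m : \forall M \near \oo, m \in box M.
Proof. by exists (\sum_(i < n) (m i).+1)%N => // M /= mM; exact: mem_box. Qed.

Lemma cvg_box : box @ \oo --> @totally {ffun 'I_n -> nat}.
Proof. exact: cvg_exhaustion near_mem_box. Qed.

End Boxes.

Lemma is_cvg_partial_sum_exhaustion (R : realType) (I : choiceType) (A : nat -> {fset I})
    (f : I -> R[i]^o) (B : R) : A @ \oo --> @totally I ->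
  (forall M, partial_sum (fun i => `|f i|) (A M) <= B%:C%C) ->
  cvg (partial_sum f @ totally).
Proof.
move=> A_cvg AB; apply: (@is_cvg_partial_sum _ _ _ B) => C.
have [N _ /(_ N (leqnn N)) CN] : \forall M \near \oo, (C `<=` A M)%fset.
  by apply: (A_cvg [set B | (C `<=` B)%fset]); exists C.
by apply: le_trans (AB N); apply: le_partial_sum => // i; rewrite normr_ge0.
Qed.

Lemma sum_index_set' (V : nmodType) n k (f : nat -> {ffun 'I_n -> 'I_k.+1} -> V) :
  \sum_(1 <= r < n.+1) \sum_(kk in index_set' n k r) f r kk =
  \sum_(kk : {ffun 'I_n -> 'I_k.+1} | admissible k (vals kk))
    f (first_big (vals kk)).+1 kk.
Proof.
under eq_bigr => r _ do rewrite big_mkcond.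
rewrite exchange_big [RHS]big_mkcond /=; apply: eq_bigr => kk _.
case: ifP => adm; last first.
  rewrite big_nat_cond big1 // => r /[!andbT] r1n.
  by rewrite mem_index_set' // adm.
have := first_big_lt adm; rewrite size_vals => fn.
rewrite (bigD1_seq (first_big (vals kk)).+1) ?iota_uniq ?mem_index_iota //=.
rewrite mem_index_set' // adm eqxx /= big_nat_cond big1 ?addr0 // => r.
by move=> /andP[r1n rf]; rewrite mem_index_set' // (negPf rf) andbF.
Qed.

(** * Summability and passage to the limit *)

Section Main.
Variables (R : realType) (n h : nat) (t : R[i]).
Hypothesis t_le1 : `|t| <= 1.
Local Notation k := (n + h.+2)%N.

(** Up to 2^(n+1), the absolute values are bounded by terms with numerators 1. Those for one [kk]
    are part of the sum over all admissible lists, which is [Tsum] and hence bounded in M. *)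
Lemma cvg_multi_term r (kk : {ffun 'I_n.+1 -> 'I_k.+1}) :
  (1 <= r <= n.+1)%N -> kk \in index_set' n.+1 k r ->
  cvg (partial_sum (multi_term r t kk) @ totally).
Proof.
move=> r1n; rewrite mem_index_set' // => /andP[adm /eqP rE].
have /andP[_ rn] := r1n.
apply: (@is_cvg_partial_sum_exhaustion _ _ _ _
  ((2 ^ n.+1 * (2 + 4 * n.+1 ^ 2 * n.+1`!))%N%:R) (@cvg_box _)) => M.
rewrite rmorph_nat natrM natrX.
apply: le_trans (ler_wpM2l _ (Tsum_le _ M n h)); last by rewrite exprn_ge0.
have := Zsum_admissible M t false 0 (ltnSn k) => <-.
rewrite ger0_norm; last first.
  by apply: sumr_ge0 => g _; apply: sumr_ge0 => m _; exact: chain_term_ge0.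
apply: (@le_trans _ _ (2 ^+ n.+1 * \sum_(m : {ffun 'I_n.+1 -> 'I_M} |
    (0 + sumn [seq (val i).+1 | i <- codom m] <= M)%N)
    chain_term t false 0 (vals kk) [seq val i | i <- codom m])).
  rewrite partial_sum_box mulr_sumr; apply: ler_sum => m _.
  rewrite multi_termE // codom_ffun_val.
  apply: le_trans (chain_term_norm _ _ _ _ t_le1) _.
  by rewrite size_map size_codom card_ord.
rewrite ler_wpM2l ?exprn_ge0 // /Zsum (bigD1 kk) //= lerDl.
by apply: sumr_ge0 => g _; apply: sumr_ge0 => m _; exact: chain_term_ge0.
Qed.

Lemma series_partial_sum (f : nat -> R[i]^o) N :
  partial_sum f (seq_fset tt (iota 0 N)) = series f N.
Proof.
rewrite partial_sumE -[RHS]/(\sum_(0 <= i < N) f i) /index_iota subn0.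
apply/perm_big/uniq_perm; [exact: fset_uniq|exact: iota_uniq|].
by move=> i; rewrite seq_fsetE.
Qed.

Lemma cvg_single_term e : (1 < e)%N -> cvgn (series (single_term e t)).
Proof.
case: e => [|[|e]] // _.
pose A N : {fset nat} := seq_fset tt (iota 0 N).
have A_cvg : A @ \oo --> @totally nat.
  apply: cvg_exhaustion => i; exists i.+1 => // N /= iN.
  by rewrite seq_fsetE mem_iota.
have -> : series (single_term e.+2 t) = partial_sum (single_term e.+2 t) \o A.
  by apply/funext => N; rewrite /= series_partial_sum.
have /cvg_ex[l fl] : cvg (partial_sum (single_term e.+2 t) @ totally).
  (* 4 = 2 * 2, from |1 - t^m| <= 2 and the bound 2 for the sum of the inverse powers. *)
  apply: (@is_cvg_partial_sum_exhaustion _ _ _ _ 4 A_cvg) => N.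
  rewrite rmorph_nat (series_partial_sum (fun i => `|_ i| : R[i]^o)) /series /=.
  rewrite big_mkord (_ : 4 = 2 * 2 :> R[i]); last by rewrite -natrM.
  apply: le_trans (ler_wpM2l _ (sum_inv_exp_le _ N e)); last by [].
  rewrite mulr_sumr; apply: ler_sum => l _; rewrite /single_term normrM.
  rewrite normfV normrX normr_nat ler_wpM2r ?invr_ge0 ?exprn_ge0 //.
  by rewrite (le_trans (ler_normB _ _)) // normr1 normrX lerD2l exprn_ile1.
by apply/cvg_ex; exists l; exact: cvg_comp A_cvg fl.
Qed.

Lemma sum_box M :
  \sum_(1 <= r < n.+2) \sum_(kk in index_set' n.+1 k r)
     partial_sum (multi_term r t kk) (box n.+1 M)
  = Psum M t n.+1 h 0.
Proof.
have := Zsum_admissible M t true 0 (ltnSn k) => <-.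
rewrite (sum_index_set' (fun r kk => partial_sum (multi_term r t kk) (box n.+1 M))).
apply: eq_bigr => kk adm; rewrite partial_sum_box; apply: eq_bigr => m _.
have := first_big_lt adm; rewrite size_vals => fn.
by rewrite multi_termE // codom_ffun_val.
Qed.

(** The finite sums commute with the limit along the boxes, where the truncated left-hand side is
    [Psum]; its distance to the truncated series tends to 0. *)
Lemma sum_multi_term :
  \sum_(1 <= r < n.+2) \sum_(kk in index_set' n.+1 k r)
     summability.sum (multi_term r t kk)
  = limn (series (single_term k t)).
Proof.
have cL : (fun M => \sum_(1 <= r < n.+2) \sum_(kk in index_set' n.+1 k r)
     partial_sum (multi_term r t kk) (box n.+1 M) : R[i]^o) @ \oo -->
   (\sum_(1 <= r < n.+2) \sum_(kk in index_set' n.+1 k r)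
     summability.sum (multi_term r t kk) : R[i]^o).
  rewrite (sum_index_set' (fun r kk => summability.sum (multi_term r t kk))).
  under eq_fun => M do
    rewrite (sum_index_set' (fun r kk => partial_sum (multi_term r t kk) (box n.+1 M))).
  apply: cvg_big => [|kk adm]; first exact: add_continuous.
  have := first_big_lt adm; rewrite size_vals => fn.
  apply: cvg_comp (@cvg_box _) _; apply: cvg_multi_term; first by rewrite ltnS.
  by rewrite mem_index_set' ?ltnS // adm eqxx.
have := cvgB cL (@cvg_Psum_dist R n h t t_le1); rewrite subr0.
rewrite [X in X @ \oo](_ : _ = series (single_term k t)) => [cL'|].
  by apply/esym/cvg_lim => //; exact: cL'.
apply/funext => M; rewrite !fctE sum_box opprB addrC subrK /series /= big_add1 /=.
by apply: eq_bigr => j _; rewrite /single_term !addnS.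
Qed.

End Main.

Theorem corollary1p3 (R : realType) (n k : nat) (n_gt0 : (0 < n)%N)
    (lt_nk : (n < k)%N) (t : R[i]) (t_le1 : `|t| <= 1) :
  [/\ forall (r : nat) (kk : {ffun 'I_n -> 'I_k.+1}),
        (1 <= r <= n)%N -> kk \in index_set' n k r ->
        cvg (partial_sum (multi_term r t kk) @ totally),
      cvgn (series (single_term k t))
    & \sum_(1 <= r < n.+1) \sum_(kk in index_set' n k r)
        summability.sum (multi_term r t kk)
      = limn (series (single_term k t))].
Proof.
case: n n_gt0 lt_nk => // n _ lt_nk.
(* Here n is one less than in the statement, and h = k - n - 2 is the excess over the least
   admissible weight n + 2. *)
have -> : k = (n + (k - n.+2).+2)%N by lia.
split; first by move=> r kk; exact: cvg_multi_term.
  by apply: cvg_single_term => //; rewrite !addnS.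
exact: sum_multi_term.
Qed.
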